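(* Let $T$ be a tree rooted at $o$ and let $\psi:T\to\mathbb{C}$ be a function. Then the following statements are equivalent. (a) $M_\psi$ is bounded on $\mathcal{L}_{\mathbf{w}}$. (b) $M_\psi$ is bounded on $\mathcal{L}_{\mathbf{w},0}$. (c) $\psi\in L^\infty$ and $\sup_{v\in T^*}|v|\log|v|\,D\psi(v)<\infty$.
   Context: A tree $T$ is a locally finite, connected, simply-connected graph, identified with its set of vertices; $T$ is assumed to have no terminal vertices (vertices with exactly one neighbor), so it is infinite, and it is rooted at a vertex $o$. $|v|$ is the number of edges in the unique path from $o$ to $v$; $T^*=T\setminus\{o\}$; for $v\in T^*$, $v^-$ is the neighbor of $v$ closest to $o$. For $f:T\to\mathbb{C}$ and $v\in T^*$, $Df(v)=|f(v)-f(v^-)|$. The weighted Lipschitz space $\mathcal{L}_{\mathbf{w}}$ is the set of $f:T\to\mathbb{C}$ with $\sup_{v\in T^*}|v|Df(v)<\infty$, normed by $\|f\|_{\mathbf{w}}=|f(o)|+\sup_{v\in T^*}|v|Df(v)$ (a Banach space). The little weighted Lipschitz space $\mathcal{L}_{\mathbf{w},0}$ is the closed subspace of those $f\in\mathcal{L}_{\mathbf{w}}$ with $\lim_{|v|\to\infty}|v|Df(v)=0$. $L^\infty$ is the space of bounded functions on $T$ with $\|f\|_\infty=\sup_{v\in T}|f(v)|$. $M_\psi f=\psi f$ (pointwise product); ''$M_\psi$ is bounded on $X$'' means $M_\psi$ maps $X$ into $X$ and is a bounded linear operator there. *)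

(* Defs.v *)
From mathcomp Require Import all_boot all_order all_algebra.
From mathcomp Require Import complex.
From mathcomp Require Import all_classical all_reals all_analysis.

Set Implicit Arguments.
Unset Strict Implicit.
Unset Printing Implicit Defensive.

Import Order.TTheory GRing.Theory Num.Theory.
Import numFieldNormedType.Exports.
Local Open Scope classical_set_scope.
Local Open Scope ring_scope.

Section Tree.
Variables (T : choiceType) (e : rel T).

Record is_tree : Prop := IsTree {
  tree_sym : symmetric e;
  tree_irr : irreflexive e;
  tree_connected : forall x y, exists2 p, path e x p & last x p = y;
  (* ucycle e [:: x; y] holds for every edge x - y, so only closed simple paths
     through at least three vertices are genuine cycles *)
  tree_acyclic : forall c, ucycle e c -> (size c <= 2)%N;
  tree_locally_finite : forall v, finite_set [set w | e v w]
}.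

Definition terminal (v : T) : Prop := exists! w, e v w.

Variable o : T.

(* path e o p excludes the initial vertex o from p, so size p counts edges. *)
Definition depth (v : T) : nat :=
  xget 0%N [set n | exists p, [/\ path e o p, uniq (o :: p), last o p = v
                                & size p = n]].

(* The value at v = o is junk; it only ever occurs with weight depth o = 0. *)
Definition parent (v : T) : T :=
  xget o [set w | e v w /\ forall u, e v u -> (depth w <= depth u)%N].

Definition infinity_filter : set_system T :=
  filter_from setT (fun N : nat => [set v | (N <= depth v)%N]).

Variable R : realType.

Definition cabs (z : R[i]) : R := Normc.normc z.

Definition Dv (f : T -> R[i]) (v : T) : R := cabs (f v - f (parent v)).

Definition wDv (f : T -> R[i]) (v : T) : R := (depth v)%:R * Dv f v.

Definition Lw : set (T -> R[i]) :=
  [set f | has_ubound [set wDv f v | v in [set v | v != o]]].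

Definition normw (f : T -> R[i]) : R :=
  cabs (f o) + sup [set wDv f v | v in [set v | v != o]].

Definition Lw0 : set (T -> R[i]) :=
  [set f | Lw f /\ wDv f v @[v --> infinity_filter] --> (0 : R)].

Definition Linfty : set (T -> R[i]) :=
  [set f | has_ubound (range (fun v => cabs (f v)))].

Definition bounded_operator_on (X : set (T -> R[i])) (N : (T -> R[i]) -> R)
    (A : (T -> R[i]) -> (T -> R[i])) : Prop :=
  [/\ forall f, X f -> X (A f),
      forall (a : R[i]) f g, X f -> X g -> A (a *: f + g) = a *: A f + A g
    & exists K : R, forall f, X f -> N (A f) <= K * N f].

Definition mult_op (psi f : T -> R[i]) : T -> R[i] := psi \* f.

End Tree.

Arguments Lw {T} e o {R}.
Arguments Lw0 {T} e o {R}.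
Arguments normw {T} e o {R}.
Arguments Linfty {T R}.

(* Main.v *)
(* Necessity: the functions 1_{v}/|v| and min(log|.|, log|v|) lie in the little
   space with norm at most 2.  The first bounds psi(v); for the second, f Dpsi
   differs from D(psi f) by psi(v^-) Df, which leaves log|v| |v| Dpsi(v) bounded.
   Sufficiency: D(psi f)(v) <= |psi(v)| Df(v) + |f(v^-)| Dpsi(v), and summing Df
   along the path from the root gives |f(v)| <= (1 + log|v|) ||f||.  In the little
   space the same summation gives |f(v)| <= C + eps log|v| for every eps > 0, so
   the last term tends to 0. *)
Require Import Defs.
From mathcomp Require Import all_boot all_order all_algebra.
From mathcomp Require Import complex.
From mathcomp Require Import all_classical all_reals all_analysis.
From mathcomp Require Import ring lra.
Import Order.TTheory GRing.Theory Num.Theory.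
Import numFieldNormedType.Exports.
Local Open Scope classical_set_scope.
Local Open Scope ring_scope.

(** * Simple paths in a tree, and depth along edges and parents *)

Section TreeDepth.
Variables (T : choiceType) (e : rel T) (o : T).
Hypothesis treeT : is_tree e.

(** Following one arc forward and the other backward closes up to a simple cycle with
    [size p + size q + 2] vertices; acyclicity allows at most two. *)
Lemma tree_arcs_nil x w p q :
    path e x (rcons p w) -> uniq (x :: rcons p w) ->
    path e x (rcons q w) -> uniq (x :: rcons q w) ->
  ~~ has (mem p) q -> p = [::] /\ q = [::].
Proof.
move=> pathp uniqp pathq uniqq disj.
have cyc : ucycle e (x :: p ++ w :: rev q).
  apply/andP; split.
    rewrite /= rcons_cat rcons_cons -cat_rcons cat_path pathp last_rcons /=.
    rewrite -rev_cons -(belast_rcons x q w) -{1}(last_rcons x q w) rev_path.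
    by under eq_path do rewrite (tree_sym treeT).
  move: uniqp uniqq; rewrite /= !mem_rcons !rcons_uniq mem_cat !inE mem_rev.
  rewrite !negb_or cat_uniq /= mem_rev rev_uniq has_rev negb_or.
  move=> /andP[/andP[-> ->] /andP[-> ->]] /andP[/andP[_ ->] /andP[-> ->]].
  by rewrite /= andbT.
move: (tree_acyclic treeT cyc); rewrite /= size_cat /= size_rev addnS !ltnS.
by rewrite leqn0 addn_eq0 !size_eq0 => /andP[/eqP-> /eqP->].
Qed.

(** Common first steps are stripped by induction. If the first steps differ, cutting both paths at
    the first vertex of the second that lies on the first leaves internally disjoint arcs; by
    [tree_arcs_nil] both are the same single edge, a contradiction. *)
Lemma tree_simple_path_inj x p q :
    path e x p -> uniq (x :: p) -> path e x q -> uniq (x :: q) ->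
  last x p = last x q -> p = q.
Proof.
elim: p x q => [|y p IH] x [|z q] //.
- move=> _ _ _ /= /andP[xq _] xE.
  by move: xq; rewrite {1}xE mem_last.
- move=> _ /= /andP[xp _] _ _ xE.
  by move: xp; rewrite -{1}xE mem_last.
have [->|yz] := eqVneq y z.
  move=> /= /andP[_ pp] /andP[_ up] /andP[_ pq] /andP[_ uq] lpq.
  by rewrite (IH z q).
move=> pathp uniqp pathq uniqq lastpq; exfalso; move/eqP: yz; apply.
have : has (mem (y :: p)) (z :: q).
  apply/hasP; exists (last z q); first exact: mem_last.
  by rewrite -[last z q]/(last x (z :: q)) -lastpq; exact: (mem_last y p).
(* The first vertices are recorded before the paths are generalized, so that they survive the
   cutting. *)
have: ohead (y :: p) = Some y by [].
have: ohead (z :: q) = Some z by [].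
move: (y :: p) (z :: q) pathp uniqp pathq uniqq {IH lastpq} => {}p {}q.
move=> pathp uniqp pathq uniqq hq hp hpq.
move: pathq uniqq hq; case/split_find: hpq => w q1 q2 wp disj.
rewrite cat_path -cat_cons cat_uniq => /andP[pathq _] /andP[uniqq _].
move: pathp uniqp hp disj; case/splitPr: wp => p1 p2.
rewrite -cat_rcons cat_path -cat_cons cat_uniq => /andP[pathp _] /andP[uniqp _].
move=> hp disj.
have [|p0 q0] := tree_arcs_nil _ _ _ _ pathp uniqp pathq uniqq.
  apply: contra disj => /hasP[u uq up]; apply/hasP; exists u => //=.
  by rewrite /= mem_cat mem_rcons inE [u \in p1]up orbT.
by rewrite p0 q0 /= in hp *; move=> [] <-; case: hp.
Qed.

(** Uniqueness of simple paths leaves only one candidate for the choice in [depth]. *)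
Lemma depth_size v p :
  path e o p -> uniq (o :: p) -> last o p = v -> depth e o v = size p.
Proof.
move=> pp up lp; apply: xget_unique; first by exists p.
move=> _ [q [pq uq lq <-]]; congr size.
by apply: (tree_simple_path_inj _ _ _ pq uq pp up); rewrite lp.
Qed.

Lemma depthP v :
  exists p, [/\ path e o p, uniq (o :: p), last o p = v & depth e o v = size p].
Proof.
have [p pp pv] := tree_connected treeT o v.
move: pv; case/shortenP: pp => q pq uq _ qv.
by exists q; split => //; apply: depth_size.
Qed.

Lemma depth_root : depth e o o = 0%N.
Proof. exact: (@depth_size _ [::]). Qed.

(** The simple path from the root to [w] either passes through [v], and is cut there, or extends to
    [v] by one edge. *)
Lemma depth_neighbor v w : e v w -> (depth e o v <= (depth e o w).+1)%N.
Proof.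
move=> evw; have [q [pq uq qw ->]] := depthP w.
have [vq|vq] := boolP (v \in o :: q).
  move: pq uq; case/splitPl: vq => q1 q2 vE.
  rewrite cat_path -cat_cons cat_uniq => /andP[pq _] /andP[uq _].
  by rewrite (@depth_size v q1)// size_cat leqW// leq_addr.
rewrite (@depth_size v (rcons q v)) ?last_rcons ?size_rcons//.
  by rewrite rcons_path pq qw (tree_sym treeT).
by rewrite -rcons_cons rcons_uniq vq uq.
Qed.

(** The vertex before [v] on the simple path from the root is one level up, and [depth_neighbor]
    makes it of least depth among the neighbors; hence the choice in [parent] is not a default. *)
Lemma depth_parent v : v != o -> depth e o v = (depth e o (parent e o v)).+1.
Proof.
move=> vo; have [p [pp up pv dv]] := depthP v.
case/lastP: p pp up pv dv => [|p u]; first by move=> _ _ /= ov; rewrite ov eqxx in vo.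
rewrite rcons_path last_rcons size_rcons => /andP[pp eu] up uv dv; subst u.
have du : depth e o (last o p) = size p.
  apply: depth_size => //.
  by move: up; rewrite -rcons_cons rcons_uniq => /andP[].
have evu : e v (last o p) by rewrite (tree_sym treeT).
have [|evp minp] := @xgetPex _ o [set w | e v w /\
    forall u, e v u -> (depth e o w <= depth e o u)%N].
  exists (last o p); split => // w evw.
  by rewrite du -ltnS -dv depth_neighbor.
apply/eqP; rewrite eqn_leq depth_neighbor//= dv ltnS -du.
exact: minp.
Qed.

Lemma depth_gt0 v : (0 < depth e o v)%N = (v != o).
Proof.
apply/idP/idP => [|/depth_parent->//].
by apply: contraTneq => ->; rewrite depth_root.
Qed.

Lemma parent_neq v : v != o -> parent e o v != v.
Proof.
move=> /depth_parent; apply: contra_eq_neq => ->.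
by rewrite neq_ltn ltnSn.
Qed.

End TreeDepth.

(** * Complex modulus and estimates on logarithms of integers *)

Section Preliminaries.
Variable R : realType.
Implicit Types (x y z : R[i]) (n : nat).

Lemma cabsM x y : cabs (x * y) = cabs x * cabs y.
Proof. exact: Normc.normcM. Qed.

Lemma cabsN x : cabs (- x) = cabs x.
Proof. exact: normcN. Qed.

Lemma cabs0 : cabs (0 : R[i]) = 0.
Proof. exact: Normc.normc0. Qed.

Lemma ler_cabsD x y : cabs (x + y) <= cabs x + cabs y.
Proof. exact: le_normcD. Qed.

Lemma ler_cabsB x y : cabs (x - y) <= cabs x + cabs y.
Proof. by rewrite -(cabsN y) ler_cabsD. Qed.

Lemma cabs_ge0 x : 0 <= cabs x.
Proof. by case: x => a b; rewrite sqrtr_ge0. Qed.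

Lemma cabs_real (r : R) : cabs (r%:C)%C = `|r|.
Proof. by rewrite /cabs /= expr0n addr0 sqrtr_sqr. Qed.

(** This is [ln (1 + x) <= x] at [x = - 1 / (n + 1)]; it compares path sums of [1 / |v|] with the
    logarithm. *)
Lemma invS_le_lnB n : (0 < n)%N -> n.+1%:R^-1 <= ln n.+1%:R - ln n%:R :> R.
Proof.
move=> n0; rewrite -lerN2 opprB -ln_div ?posrE ?ltr0n//.
have -> : n%:R / n.+1%:R = 1 + - n.+1%:R^-1 :> R.
  by rewrite -natr1; field; rewrite natr1 pnatr_eq0.
by apply: le_ln1Dx; rewrite ltrN2 invf_lt1 ?ltr1n ?ltr0n.
Qed.

(** The same inequality at [x = 1 / n]; it controls the increments of the logarithmic test
    function. *)
Lemma lnB_le_inv n : (0 < n)%N -> ln n.+1%:R - ln n%:R <= n%:R^-1 :> R.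
Proof.
move=> n0; rewrite -ln_div ?posrE ?ltr0n//.
have -> : n.+1%:R / n%:R = 1 + n%:R^-1 :> R.
  by rewrite -natr1; field; rewrite pnatr_eq0 -lt0n.
by apply: le_ln1Dx; rewrite (@lt_le_trans _ _ 0)// invr_ge0.
Qed.

Lemma ln_nat_ge0 n : 0 <= ln n%:R :> R.
Proof. by case: n => [|n]; [rewrite ln0 | rewrite ln_ge0// ler1n]. Qed.

Lemma ler_ln_nat m n : (m <= n)%N -> ln m%:R <= ln n%:R :> R.
Proof.
case: m => [|m] mn; first by rewrite ln0 ?ln_nat_ge0.
by rewrite ler_ln ?posrE ?ltr0n ?ler_nat// (leq_trans _ mn).
Qed.

(** From depth 2 on, this absorbs the constant 1 into [2 * ln n]. *)
Lemma ln_nat_ge_half n : (1 < n)%N -> 2^-1 <= ln n%:R :> R.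
Proof.
move=> /ler_ln_nat; apply: le_trans.
by have := @invS_le_lnB 1 isT; rewrite ln1 subr0.
Qed.

End Preliminaries.

(** * The weighted norm, the product rule and logarithmic growth *)

Section Lipschitz.
Variables (R : realType) (T : choiceType) (e : rel T) (o : T).
Hypothesis treeT : is_tree e.
Implicit Types (f psi : T -> R[i]) (v : T) (C eps : R).

Let d := depth e o.

Lemma Dv_ge0 f v : 0 <= Dv e o f v.
Proof. exact: cabs_ge0. Qed.

Lemma wDv_ge0 f v : 0 <= wDv e o f v.
Proof. by rewrite mulr_ge0 ?Dv_ge0. Qed.

Lemma infinity_cvg0P (h : T -> R) :
  (h v @[v --> infinity_filter e o] --> (0 : R)) <->
  (forall eps, 0 < eps -> exists N : nat, forall v, (N <= d v)%N -> `|h v| < eps).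
Proof.
have FF : Filter (infinity_filter e o).
  apply: filter_fromT_filter; first by exists 0%N.
  by move=> i j; exists (maxn i j) => v /=; rewrite geq_max => /andP[].
rewrite cvgr0Pnorm_lt; split => H eps eps0.
- by have [N _ HN] := H _ eps0; exists N => v; exact: HN.
- by have [N HN] := H _ eps0; exists N.
Qed.

Lemma cabs_root_le_normw f : cabs (f o) <= normw e o f.
Proof.
rewrite lerDl; set S := [set _ | _ in _].
(* A set without supremum has [sup] equal to 0 by default. *)
have [[[x Sx] ubS]|nS] := pselect (has_sup S); last by rewrite sup_out.
by apply: (@le_trans _ _ x); [case: Sx => v _ <-; exact: wDv_ge0 | exact: ub_le_sup].
Qed.

Lemma normw_ge0 f : 0 <= normw e o f.
Proof. exact: le_trans (cabs_ge0 _ _) (cabs_root_le_normw f). Qed.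

Lemma wDv_le_normw f v :
  Lw e o f -> v != o -> cabs (f o) + wDv e o f v <= normw e o f.
Proof. by move=> Lf vo; rewrite lerD2l; apply: ub_le_sup => //; exists v. Qed.

Lemma Lw_bound f C : (forall v, v != o -> wDv e o f v <= C) -> Lw e o f.
Proof. by move=> fC; exists C => _ [v /= vo <-]; exact: fC. Qed.

Lemma normw_le f C : 0 <= C -> (forall v, v != o -> wDv e o f v <= C) ->
  normw e o f <= cabs (f o) + C.
Proof.
move=> C0 fC; rewrite lerD2l.
have [->|/set0P ne] := eqVneq [set wDv e o f v | v in [set v | v != o]] set0.
  by rewrite sup0.
by apply: ge_sup => // _ [v /= vo <-]; exact: fC.
Qed.

(** With [p] the parent of [v], the increment of the product splits as [psi v * (f v - f p) + f p *
    (psi v - psi p)]. *)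
Lemma wDv_mult_le psi f v :
  wDv e o (mult_op psi f) v <=
  cabs (psi v) * wDv e o f v + cabs (f (parent e o v)) * wDv e o psi v.
Proof.
rewrite /wDv !(mulrCA _ (_%:R)) -mulrDr ler_wpM2l// /Dv -!cabsM.
have := ler_cabsD _ (psi v * (f v - f (parent e o v)))
  (f (parent e o v) * (psi v - psi (parent e o v))).
by congr (_ <= _); congr cabs; rewrite /mult_op /=; ring.
Qed.

(* Summing Df along the path from the root: the increments
   Df(v) <= eps / |v| are dominated by those of eps * ln. *)
Lemma cabs_le_ln f (N : nat) C eps : (0 < N)%N -> 0 <= eps ->
    (forall v, (d v <= N)%N -> cabs (f v) <= C) ->
    (forall v, (N < d v)%N -> wDv e o f v <= eps) ->
  forall v, cabs (f v) <= C + eps * ln (d v)%:R.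
Proof.
move=> N0 eps0 fC feps v.
elim: {v}(d v) {-2}v (leqnn (d v)) => [|n IH] v dn.
  rewrite (le_trans (fC _ _)) ?(leq_trans dn)//.
  by rewrite lerDl mulr_ge0 ?ln_nat_ge0.
have [dN|Nd] := leqP (d v) N.
  by rewrite (le_trans (fC _ dN))// lerDl mulr_ge0 ?ln_nat_ge0.
have vo : v != o by rewrite -(depth_gt0 _ _ _ treeT) (leq_trans _ Nd).
have dv : d v = (d (parent e o v)).+1 by exact: depth_parent.
have := IH (parent e o v); rewrite -ltnS -dv => /(_ dn) {}IH.
have := feps _ Nd; rewrite /wDv -/d -ler_pdivlMl ?ltr0n ?(leq_trans _ Nd)//.
move=> Df; have -> : f v = (f v - f (parent e o v)) + f (parent e o v) by ring.
have p0 : (0 < d (parent e o v))%N by rewrite -ltnS -dv (leq_ltn_trans N0).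
have := @invS_le_lnB R _ p0; rewrite -dv => /(ler_wpM2l eps0) dln.
apply: (le_trans (ler_cabsD _ _ _)); apply: (le_trans (lerD Df IH)).
by move: dln; lra.
Qed.

(** An instance of [cabs_le_ln] with cutoff depth 1 and both constants equal to the norm: at depth 1
    the weight is 1 and the parent is the root. *)
Lemma cabs_le_normw f v :
  Lw e o f -> cabs (f v) <= normw e o f * (1 + ln (d v)%:R).
Proof.
move=> Lf; rewrite mulrDr mulr1; apply: (@cabs_le_ln _ 1) => //.
- exact: normw_ge0.
- move=> {}v dv1; have [->|vo] := eqVneq v o; first exact: cabs_root_le_normw.
  apply: le_trans (wDv_le_normw _ _ Lf vo).
  have dv : d v = (d (parent e o v)).+1 by exact: depth_parent.
  have po : parent e o v = o.
    by apply/eqP; rewrite -[_ == _]negbK -(depth_gt0 _ _ _ treeT) -leqNgt -ltnS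
       -/d -dv.
  rewrite /wDv -/d dv po /d depth_root// mul1r /Dv po addrC -{1}(subrK (f o) (f v)).
  exact: ler_cabsD.
- move=> {}v dv; have vo : v != o by rewrite -(depth_gt0 _ _ _ treeT) (leq_trans _ dv).
  by apply: le_trans (wDv_le_normw _ _ Lf vo); rewrite lerDr cabs_ge0.
Qed.

End Lipschitz.

Section Multipliers.
Variables (R : realType) (T : choiceType) (e : rel T) (o : T).
Hypothesis treeT : is_tree e.
Variable psi : T -> R[i].
Implicit Types (f : T -> R[i]) (v : T) (C eps : R).

Let d := depth e o.


Lemma mult_op_linear (a : R[i]) f g :
  mult_op psi (a *: f + g) = a *: mult_op psi f + mult_op psi g.
Proof.
apply/funext => v; rewrite /mult_op /= !fctE.
by rewrite mulrDr; congr (_ + _); rewrite /GRing.scale /=; ring.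
Qed.

(** * Condition (c) implies boundedness on both spaces *)

Section Sufficiency.
Variable B : R.
Hypothesis B_ge0 : 0 <= B.
Hypothesis psi_le : forall v, cabs (psi v) <= B.
Hypothesis Dpsi_le : forall v, (1 < d v)%N -> ln (d v)%:R * wDv e o psi v <= B.

Lemma wDv_mult_le_normw f v :
  Lw e o f -> v != o -> wDv e o (mult_op psi f) v <= 4 * B * normw e o f.
Proof.
move=> Lf vo; set N := normw e o f; have N0 : 0 <= N by exact: normw_ge0.
apply: le_trans (wDv_mult_le _ _ _ _ _ _ _) _.
have dv : d v = (d (parent e o v)).+1 by exact: depth_parent.
have Df : wDv e o f v <= N.
  by apply: le_trans (wDv_le_normw _ _ _ _ _ _ Lf vo); rewrite lerDr cabs_ge0.
have H1 : cabs (psi v) * wDv e o f v <= B * N.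
  by rewrite ler_pM ?cabs_ge0 ?wDv_ge0.
(* The constant 4 is 1 from [psi v * Df v] and 3 from the remaining term. *)
suff : cabs (f (parent e o v)) * wDv e o psi v <= 3 * B * N by lra.
have fp := cabs_le_normw _ _ _ _ treeT _ (parent e o v) Lf.
(* At depth 1 the logarithm vanishes and [Dpsi_le] gives nothing; there [Dpsi] is at most [2 * B]
   because [psi] is bounded. *)
have [dv1|dv1] := leqP (d v) 1.
  have dp : d (parent e o v) = 0%N by move: dv1; rewrite dv ltnS leqn0 => /eqP.
  have {}fp : cabs (f (parent e o v)) <= N.
    by move: fp; rewrite -/d dp ln0// addr0 mulr1.
  have Dp : wDv e o psi v <= 2 * B.
    rewrite /wDv -/d dv dp mul1r.
    have := ler_cabsB _ (psi v) (psi (parent e o v)).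
    by have := psi_le v; have := psi_le (parent e o v); rewrite /Dv; lra.
  apply: (@le_trans _ _ (N * (2 * B))); first by rewrite ler_pM ?cabs_ge0 ?wDv_ge0.
  by have := mulr_ge0 B_ge0 N0; lra.
have l2 := ln_nat_ge_half R _ dv1.
have lp : ln (d (parent e o v))%:R <= ln (d v)%:R :> R by rewrite ler_ln_nat// dv.
(* Since [1 <= 2 * ln |v|], the factor [1 + ln |v^-|] is at most [3 * ln |v|]. *)
have {}fp : cabs (f (parent e o v)) <= 3 * N * ln (d v)%:R.
  apply: (le_trans fp); rewrite -/d -/N (mulrC 3) -mulrA ler_wpM2l//.
  by move: l2 lp; lra.
apply: (@le_trans _ _ (3 * N * ln (d v)%:R * wDv e o psi v)).
  by rewrite ler_wpM2r ?wDv_ge0.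
rewrite -mulrA (_ : 3 * B * N = 3 * N * B); last by ring.
by rewrite ler_wpM2l ?Dpsi_le// mulr_ge0.
Qed.

Lemma mult_Lw f : Lw e o f -> Lw e o (mult_op psi f).
Proof. by move=> Lf; apply: Lw_bound => v; exact: wDv_mult_le_normw. Qed.

Lemma normw_mult_le f :
  Lw e o f -> normw e o (mult_op psi f) <= 5 * B * normw e o f.
Proof.
move=> Lf; have N0 := normw_ge0 _ _ e o f.
apply: le_trans (normw_le _ _ _ _ _ (4 * B * normw e o f) _ _) _.
- by rewrite !mulr_ge0.
- by move=> v; exact: wDv_mult_le_normw.
suff : cabs (mult_op psi f o) <= B * normw e o f by lra.
by rewrite cabsM ler_pM ?cabs_ge0// cabs_root_le_normw.
Qed.

Lemma mult_Lw0 f : Lw0 e o f -> Lw0 e o (mult_op psi f).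
Proof.
move=> [Lf /infinity_cvg0P f0]; split; first exact: mult_Lw.
apply/infinity_cvg0P => eps eps0.
have B1 : 0 < 4 * (B + 1) by have := B_ge0; lra.
(* The final estimate is [(2 * B + 1) * eps'], which is strictly below [eps]. *)
set eps' := eps / (4 * (B + 1)).
have eps'0 : 0 < eps' by rewrite divr_gt0.
have [N HN] := f0 _ eps'0.
(* [A] bounds [f] up to depth [N.+1]; the successor keeps the cutoff of [cabs_le_ln] positive. *)
pose A := normw e o f * (1 + ln N.+1%:R).
have A0 : 0 <= A by rewrite mulr_ge0 ?normw_ge0 ?addr_ge0 ?ln_nat_ge0.
have fA v : cabs (f v) <= A + eps' * ln (d v)%:R.
  move: v; apply: (@cabs_le_ln _ _ _ _ treeT _ N.+1) => [//||v dv|v dv].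
  - exact: ltW.
  - apply: (le_trans (cabs_le_normw _ _ _ _ treeT _ v Lf)).
    by rewrite ler_wpM2l ?normw_ge0// lerD2l ler_ln_nat.
  - apply/ltW/(le_lt_trans (ler_norm _)); apply: HN.
    exact: ltnW (ltnW dv).
(* Beyond this depth [A * B / ln |v| <= eps'], so the constant part of the bound on [f] contributes
   at most [eps']. *)
have [M HM] : exists M : nat, forall n, (M <= n)%N -> A * B <= eps' * ln n%:R.
  exists (Num.bound (expR (A * B / eps'))) => n Mn.
  have xn : expR (A * B / eps') < n%:R.
    by rewrite (lt_le_trans (archi_boundP (expR_ge0 _)))// ler_nat.
  rewrite [leRHS]mulrC -ler_pdivrMr// -[leLHS]expRK ler_ln ?posrE ?expR_gt0//.
    exact: ltW.
  exact: lt_trans (expR_gt0 _) xn.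
exists (maxn 2 (maxn N M)) => v; rewrite !geq_max => /and3P[dv2 dN dM].
rewrite ger0_norm ?wDv_ge0//.
apply: (le_lt_trans (wDv_mult_le _ _ _ _ _ _ _)).
have l2 := ln_nat_ge_half R _ dv2.
have dv : d v = (d (parent e o v)).+1.
  by apply: depth_parent => //; rewrite -(depth_gt0 _ _ _ treeT) (leq_trans _ dv2).
have lp : ln (d (parent e o v))%:R <= ln (d v)%:R :> R by rewrite ler_ln_nat// dv.
have W0 := wDv_ge0 _ _ e o psi v.
have H1 : cabs (psi v) * wDv e o f v <= B * eps'.
  rewrite ler_pM ?cabs_ge0 ?wDv_ge0//.
  exact: (le_trans (ler_norm _) (ltW (HN _ dN))).
have H2 : cabs (f (parent e o v)) * wDv e o psi v <=
    (A + eps' * ln (d v)%:R) * wDv e o psi v.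
  rewrite ler_wpM2r// (le_trans (fA _))// lerD2l ler_wpM2l// ltW//.
have LW := Dpsi_le _ dv2.
have H3 : eps' * ln (d v)%:R * wDv e o psi v <= eps' * B.
  by rewrite -mulrA ler_wpM2l// ltW.
have H4 : A * wDv e o psi v <= eps'.
  have l0 : 0 < ln (d v)%:R :> R by lra.
  rewrite -(ler_pM2r l0) -mulrA (mulrC (wDv _ _ _ _)).
  by apply: le_trans (HM _ dM); rewrite ler_wpM2l.
have -> : eps = eps' * (4 * (B + 1)) by rewrite divfK// gt_eqF.
have : 0 <= eps' * B by rewrite mulr_ge0// ltW.
by move: H1 H2 H3 H4; rewrite mulrDl; lra.
Qed.

End Sufficiency.

(** * Bounds on [psi] obtained from test functions in the little space *)

Section Necessity.
Variable K : R.
Hypothesis mult_Lw0_Lw : forall f, Lw0 e o f -> Lw e o (mult_op psi f).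
Hypothesis normw_mult :
  forall f, Lw0 e o f -> normw e o (mult_op psi f) <= K * normw e o f.

(** Increments vanishing from depth [N] on place [f] in [Lw0], and its norm is at most 2; [|K|]
    allows for a negative [K]. *)
Lemma wDv_mult_test f (N : nat) v : f o = 0 ->
    (forall v, v != o -> wDv e o f v <= 2) ->
    (forall v, (N <= d v)%N -> wDv e o f v = 0) ->
  v != o -> wDv e o (mult_op psi f) v <= 2 * `|K|.
Proof.
move=> fo f2 fN vo.
have Lf : Lw0 e o f.
  split; first exact: Lw_bound f2.
  by apply/infinity_cvg0P => eps eps0; exists N => w /fN ->; rewrite normr0.
apply: (@le_trans _ _ (normw e o (mult_op psi f))).
  apply: le_trans (wDv_le_normw _ _ _ _ _ _ (mult_Lw0_Lw _ Lf) vo).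
  by rewrite lerDr cabs_ge0.
apply: (le_trans (normw_mult _ Lf)).
apply: (@le_trans _ _ (`|K| * normw e o f)).
  by rewrite ler_wpM2r ?normw_ge0// ler_norm.
rewrite mulrC ler_wpM2r//.
by have := normw_le _ _ _ _ _ _ (ler0n _ 2) f2; rewrite fo cabs0 add0r.
Qed.

Lemma cabs_psi_le v : cabs (psi v) <= cabs (psi o) + 2 * `|K|.
Proof.
have [->|vo] := eqVneq v o; first by rewrite lerDl mulr_ge0.
have d0 : (0 < d v)%N by rewrite (depth_gt0 _ _ _ treeT).
have dR : 0 < (d v)%:R :> R by rewrite ltr0n.
(* The weighted increment is 1 at [v], [(|v| + 1) / |v| <= 2] at its children and 0 elsewhere. At
   [v], that of [psi f] is exactly [|psi v|]. *)
pose f w : R[i] := if w == v then ((d v)%:R^-1)%:C%C else 0.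
have fv : cabs (f v) = (d v)%:R^-1.
  by rewrite /f eqxx cabs_real ger0_norm// invr_ge0 ltW.
have pv : (parent e o v == v) = false by apply/negbTE/parent_neq.
have : wDv e o (mult_op psi f) v <= 2 * `|K|.
  (* Children of [v], at depth [(d v).+1], still have nonzero increments. *)
  apply: (wDv_mult_test _ (d v).+2) => //.
  - by rewrite /f eq_sym (negbTE vo).
  - move=> w wo; rewrite /wDv -/d /Dv.
    have dw : d w = (d (parent e o w)).+1 by exact: depth_parent.
    have [wv|wv] := eqVneq w v.
      by rewrite wv /f pv subr0 -/(f v) fv divff ?gt_eqF// ler1n.
    have [pw|pw] := eqVneq (parent e o w) v.
      rewrite dw pw [f w]/f (negbTE wv) sub0r cabsN fv -natr1 mulrDl mul1r.
      by rewrite divff ?gt_eqF// -[leRHS]/(1 + 1) lerD2l invf_le1// ler1n.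
    by rewrite /f (negbTE wv) (negbTE pw) subr0 cabs0 mulr0.
  - move=> w dw; rewrite /wDv /Dv.
    have wo : w != o by rewrite -(depth_gt0 _ _ _ treeT) (leq_trans _ dw).
    have dwE : d w = (d (parent e o w)).+1 by exact: depth_parent.
    rewrite /f ifN; last by apply: contraTneq dw => ->; rewrite -ltnNge.
    rewrite ifN ?subr0 ?cabs0 ?mulr0//.
    by apply: contraTneq dw => pw; rewrite -/d dwE pw -ltnNge.
rewrite /wDv /Dv /mult_op /= [f (parent _ _ _)]/f pv mulr0 subr0 cabsM fv -/d.
rewrite mulrCA divff ?gt_eqF// mulr1 => psi_v.
by rewrite (le_trans psi_v)// lerDr cabs_ge0.
Qed.

Lemma log_wDv_psi_le v : (1 < d v)%N ->
  ln (d v)%:R * wDv e o psi v <= 2 * cabs (psi o) + 6 * `|K|.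
Proof.
move=> d1; have vo : v != o by rewrite -(depth_gt0 _ _ _ treeT) (leq_trans _ d1).
have dp : d v = (d (parent e o v)).+1 by exact: depth_parent.
(* The truncation at depth [n] makes the increments vanish further out; the default [ln 0 = 0] gives
   [f o = 0] and a zero increment at depth 1. *)
set n := d v in d1 dp *; pose f w : R[i] := ((ln (minn (d w) n)%:R)%:C)%C.
have fB (w w' : T) : (d w' <= d w)%N -> cabs (f w - f w') =
    ln (minn (d w) n)%:R - ln (minn (d w') n)%:R.
  move=> ww'; rewrite /f -rmorphB cabs_real ger0_norm// subr_ge0 ler_ln_nat//.
  by rewrite leq_min geq_minr andbT (leq_trans (geq_minl _ _)).
have step (m : nat) : (0 < m)%N -> m.+1%:R * (ln m.+1%:R - ln m%:R) <= 2 :> R.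
  move=> m0; have := lnB_le_inv R _ m0.
  move=> /(ler_wpM2l (ler0n R m.+1)) /le_trans; apply.
  rewrite -natr1 mulrDl mul1r divff ?pnatr_eq0 -?lt0n//.
  by rewrite -[leRHS]/(1 + 1) lerD2l invf_le1 ?ler1n ?ltr0n.
have : wDv e o (mult_op psi f) v <= 2 * `|K|.
  apply: (wDv_mult_test _ n.+1) => //.
  - by rewrite /f /d depth_root// min0n ln0.
  - move=> w wo; rewrite /wDv -/d /Dv.
    have dw : d w = (d (parent e o w)).+1 by exact: depth_parent.
    rewrite fB ?dw//; move: (d (parent e o w)) => [|m].
      by rewrite min0n (minn_idPl _) ?(ltnW d1)// ln1 ln0// subr0 mulr0.
    have [mn|nm] := leqP m.+2 n.
      by rewrite (minn_idPl (ltnW mn)) step.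
    by rewrite (minn_idPr (nm : (n <= m.+1)%N)) subrr mulr0.
  - move=> w dw; rewrite /wDv /Dv -/d.
    have wo : w != o by rewrite -(depth_gt0 _ _ _ treeT) (leq_trans _ dw).
    have dwE : d w = (d (parent e o w)).+1 by exact: depth_parent.
    rewrite fB ?dwE//; move: dw; rewrite -/d dwE ltnS => dw.
    by rewrite !(minn_idPr _) ?subrr ?mulr0// leqW.
set p := parent e o v in dp *; set m := d p in dp *.
have m0 : (0 < m)%N by rewrite -ltnS -dp.
have fv : f v = ((ln n%:R)%:C)%C by rewrite /f minnn.
have fvp : cabs (f v - f p) = ln n%:R - ln m%:R.
  by rewrite fB -/n -/m ?minnn dp// (minn_idPl _).
have pK := cabs_psi_le p.
(* The product rule solved for [f v * (psi v - psi p)], where [f v = ln n] is the wanted weight. *)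
have := ler_cabsB _ (mult_op psi f v - mult_op psi f p) (psi p * (f v - f p)).
rewrite (_ : _ - _ = f v * (psi v - psi p)); last by rewrite /mult_op /=; ring.
rewrite !cabsM fvp fv cabs_real ger0_norm ?ln_nat_ge0//.
rewrite /wDv /Dv -/d -/n -/p => /(ler_wpM2l (ler0n R n)) H1 H2.
(* Added to the [2 * |K|] from the test inequality, this yields [2 * cabs (psi o) + 6 * |K|]. *)
have H3 : cabs (psi p) * (n%:R * (ln n%:R - ln m%:R)) <=
    (cabs (psi o) + 2 * `|K|) * 2.
  rewrite ler_pM ?cabs_ge0//.
    by rewrite mulr_ge0// subr_ge0 ler_ln_nat// dp.
  by rewrite dp step.
by move: H1 H2 H3; lra.
Qed.

End Necessity.

End Multipliers.

Theorem theorem4p1 (R : realType) (T : choiceType) (e : rel T) (o : T)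
    (treeT : is_tree e)
    (no_terminal : forall v : T, ~ terminal e v)
    (infiniteT : infinite_set [set: T])
    (psi : T -> R[i]) :
  let a := bounded_operator_on (Lw e o) (normw e o) (mult_op psi) in
  let b := bounded_operator_on (Lw0 e o) (normw e o) (mult_op psi) in
  let c := Linfty psi /\
    has_ubound [set (depth e o v)%:R * ln (depth e o v)%:R * Dv e o psi v
               | v in [set v | v != o]] in
  (a <-> b) /\ (b <-> c).
Proof.
move=> a b c.
(* Boundedness from [Lw0] into [Lw] follows from [a] and from [b] alike, so one argument serves
   both. *)
have nec K : (forall f, Lw0 e o f -> Lw e o (mult_op psi f)) ->
    (forall f, Lw0 e o f -> normw e o (mult_op psi f) <= K * normw e o f) -> c.
  move=> mL mK; split.
    exists (cabs (psi o) + 2 * `|K|) => _ [v _ <-].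
    exact: (cabs_psi_le _ _ _ _ treeT _ _ mL mK).
  exists (2 * cabs (psi o) + 6 * `|K|) => _ [v /= vo <-].
  rewrite (mulrC _%:R) -mulrA.
  (* At depth 1 the weight is zero because [ln 1 = 0]. *)
  have [d1|d1] := leqP (depth e o v) 1; last first.
    exact: (log_wDv_psi_le _ _ _ _ treeT _ _ mL mK).
  have -> : depth e o v = 1%N by apply/eqP; rewrite eqn_leq d1 (depth_gt0 _ _ _ treeT).
  by rewrite ln1 mul0r addr_ge0 ?mulr_ge0 ?cabs_ge0.
have ac : a -> c.
  by move=> [aL _ [K aK]]; apply: (nec K) => f [Lf _]; [exact: aL | exact: aK].
have bc : b -> c.
  move=> [bL _ [K bK]]; apply: (nec K) => f Lf; last exact: bK.
  by have [] := bL _ Lf.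
have suf : c -> a /\ b.
  move=> [[B1 psi1] [B2 psi2]].
  pose B := `|B1| + `|B2|.
  have B0 : 0 <= B by rewrite addr_ge0.
  have psiB v : cabs (psi v) <= B.
    apply: (@le_trans _ _ B1); first by apply: psi1; exists v.
    by rewrite (le_trans (ler_norm _))// lerDl.
  have DpsiB v : (1 < depth e o v)%N ->
      ln (depth e o v)%:R * wDv e o psi v <= B.
    move=> d1; apply: (@le_trans _ _ B2).
      rewrite /wDv mulrA (mulrC (ln _)); apply: psi2; exists v => //=.
      by rewrite -(depth_gt0 _ _ _ treeT) (leq_trans _ d1).
    by rewrite (le_trans (ler_norm _))// lerDr.
  split; split.
  - by move=> f; exact: (mult_Lw _ _ _ _ treeT _ _ B0 psiB DpsiB).
  - by move=> k f g _ _; exact: mult_op_linear.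
  - by exists (5 * B) => f; exact: (normw_mult_le _ _ _ _ treeT _ _ B0 psiB DpsiB).
  - by move=> f; exact: (mult_Lw0 _ _ _ _ treeT _ _ B0 psiB DpsiB).
  - by move=> k f g _ _; exact: mult_op_linear.
  - by exists (5 * B) => f [Lf _]; exact: (normw_mult_le _ _ _ _ treeT _ _ B0 psiB DpsiB).
by split; split; [move=> /ac/suf[] | move=> /bc/suf[] | exact: bc | move=> /suf[]].
Qed.
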